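(* Let $H$ be a hypergraph and let $\{x_1,x_2,\ldots,x_\ell\}$ be the set of distinct edge sizes in $H$. Define $X=\left\{\frac{j}{x_i} \mid 1\leq i\leq \ell,\ 1\leq j\leq x_i-1\right\}$, assume $X$ is nonempty, and write its elements in increasing order as $y_1<y_2<\cdots<y_m$. Then each of the intervals $(0,y_1], (y_1,y_2],\ldots,(y_{m-1},y_m], (y_m,1)$ is a subset of some interval of the burning distribution of $H$ and a subset of some interval of the lazy burning distribution of $H$.
   Context: A hypergraph $H=(V(H),E(H))$ has a finite nonempty vertex set and a finite collection $E(H)$ of subsets of $V(H)$ called edges (parallel edges allowed). For a proportion $p\in(0,1)$, the proportion-based propagation rule is: if at the end of a round at least $\lceil p|e|\rceil$ vertices of an edge $e$ are on fire, then in the next round all vertices of $e$ catch fire; burned vertices stay burned. Burning game: let $F_0=\emptyset$ and $F_r$ be the set of burned vertices at the end of round $r$. In each round $r\geq 1$, simultaneously, vertices catch fire by propagation from $F_{r-1}$ (no propagation in round 1), and a player chooses a vertex $u_r\notin F_{r-1}$ (a source) and sets it on fire. A burning sequence is a sequence $(u_1,\ldots,u_k)$ of such sources after which every vertex is on fire at the end of round $k$; $b_p(H)$ is the minimum length of a burning sequence. Lazy game: $S\subseteq V(H)$ is a lazy burning set if, setting all of $S$ on fire at once and then repeatedly applying the propagation rule, every vertex eventually catches fire; $b_{L,p}(H)$ is the minimum size of a lazy burning set. With $n=|V(H)|$, the burning distribution is the partition of $(0,1)$ into the sets $P_j=\{p\in(0,1): b_p(H)=j\}$, and the lazy burning distribution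 into $Q_j=\{p\in(0,1): b_{L,p}(H)=j\}$, $j=1,\ldots,n$. *)

(* Defs.v *)
From HB Require Import structures.
From mathcomp Require Import all_boot all_order all_algebra.
From mathcomp Require Import all_classical all_reals all_analysis.

Set Implicit Arguments.
Unset Strict Implicit.
Unset Printing Implicit Defensive.

Import Order.TTheory GRing.Theory Num.Theory.

Local Open Scope ring_scope.

(* Edges form a sequence, so parallel (and empty) edges are allowed. *)
Record hypergraph := Hypergraph {
  vertex :> finType;
  vertex_gt0 : (0 < #|vertex|)%N;
  edges : seq {set vertex}
}.

Section Burning.
Variables (R : realType) (H : hypergraph) (p : R).
Implicit Types (F S : {set H}) (e : {set H}) (u : seq H).

Definition ignites F e : bool :=
  Num.ceil (p * #|e|%:R) <= Posz #|e :&: F|.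

Definition propagate F : {set H} :=
  F :|: [set v | has (fun e => ignites F e && (v \in e)) (edges H)]%SET.

(* For 0 < p nothing propagates from the empty set, so the first round of the
   game needs no special treatment. *)
Lemma propagate0 : 0 < p -> propagate finset.set0 = finset.set0.
Proof.
move=> p0; apply/setP => v; rewrite !inE /=; apply/negbTE/hasPn => e _.
apply/negP => /andP[+ ve]; rewrite /ignites finset.setI0 cards0.
apply/negP; rewrite -ltNge ceil_gt0 mulr_gt0// ltr0n card_gt0.
by apply/set0Pn; exists v.
Qed.

(* A round started with F on fire and with source v: propagation uses F only,
   not v. *)
Definition play_round F v : {set H} := (v |: propagate F)%SET.

Definition burned u : {set H} := foldl play_round finset.set0 u.

Fixpoint legal F u : bool :=
  if u is v :: u' then (v \notin F) && legal (play_round F v) u' else true.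

Definition burning_sequence u : bool :=
  legal finset.set0 u && (burned u == [set: H]%SET).

Lemma legal_rcons F u v :
  legal F (rcons u v) = legal F u && (v \notin foldl play_round F u).
Proof.
by elim: u F => [|w u IHu] F /=; rewrite ?andbT// IHu andbA.
Qed.

Lemma burning_sequence_exists :
  exists k, [exists u : k.-tuple H, burning_sequence u].
Proof.
suff [u Hu] : exists u, burning_sequence u.
  by exists (size u); apply/existsP; exists (in_tuple u).
suff /(_ #|H|) [u lu [/eqP bu|leu]] : forall k, exists2 u, legal finset.set0 u &
    burned u = [set: H]%SET \/ (k <= #|burned u|)%N.
- by exists u; rewrite /burning_sequence lu.
- by exists u; rewrite /burning_sequence lu eqEcard finset.subsetT cardsT.
elim=> [|k [u lu [bu|leu]]]; first by exists [::] => //; right.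
- by exists u => //; left.
have [bu|] := eqVneq (burned u) [set: H]%SET; first by exists u => //; left.
rewrite -finset.subTset => /subsetPn[v _ vu].
exists (rcons u v); first by rewrite legal_rcons lu.
right; rewrite /burned foldl_rcons -/(burned u).
apply: (leq_trans (n := #|v |: burned u|%SET)); first by rewrite cardsU1 vu.
by apply/subset_leq_card/finset.setUS/finset.subsetUl.
Qed.

Definition burning_number : nat := ex_minn burning_sequence_exists.

Definition lazy_burning_set S : Prop :=
  forall v : H, exists r : nat, v \in iter r propagate S.

Lemma lazy_burning_set_exists :
  exists k, [exists S : {set H}, (#|S| == k) && `[< lazy_burning_set S >]].
Proof.
exists #|[set: H]%SET|; apply/existsP; exists [set: H]%SET; rewrite eqxx /=.
by apply/asboolP => v; exists 0%N; rewrite inE.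
Qed.

Definition lazy_burning_number : nat := ex_minn lazy_burning_set_exists.

End Burning.

Section Distribution.
Variables (R : realType) (H : hypergraph).

Local Open Scope classical_set_scope.

(* The parts are indexed by 1, ..., #|H|; some of them may be empty. *)
Definition burning_distribution : set (set R) :=
  [set [set p : R | 0 < p < 1 /\ burning_number H p = j]
     | j in [set j : nat | (1 <= j <= #|H|)%N]].

Definition lazy_burning_distribution : set (set R) :=
  [set [set p : R | 0 < p < 1 /\ lazy_burning_number H p = j]
     | j in [set j : nat | (1 <= j <= #|H|)%N]].

Definition edge_sizes : seq nat := undup [seq #|e| | e : {set H} <- edges H].

Definition breakpoints : set R :=
  [set z | exists x j : nat,
     [/\ x \in edge_sizes, (1 <= j <= x.-1)%N & z = j%:R / x%:R]].

End Distribution.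

Arguments burning_distribution R H : clear implicits.
Arguments lazy_burning_distribution R H : clear implicits.
Arguments breakpoints R H : clear implicits.

(* For y = [:: y_1; ...; y_m] with 0 < m, this is the sequence of intervals
   ]0, y_1], ]y_1, y_2], ..., ]y_(m-1), y_m], ]y_m, 1[. *)
Definition cells (R : realType) (y : seq R) : seq (interval R) :=
  rcons (pairmap (fun a b => `]a, b]) 0 y) `]last 0 y, 1[.

(* Main.v *)
(** The proportion [p] enters the game only through the tests [p |e| <= k], where
    [k] counts the burning vertices of [e].  Decreasing [p] makes propagation easier, so
    both burning numbers are nondecreasing in [p] and the parts of both distributions
    are intervals.  For [0 < p < 1] a test can change its value only at some [k / |e|]
    with [0 < k < |e|], so the whole game is the same throughout a cell. *)
Require Import Defs.
From mathcomp Require Import all_boot all_order all_algebra.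
From mathcomp Require Import all_classical all_reals all_analysis.
Import Order.TTheory GRing.Theory Num.Theory.
Local Open Scope classical_set_scope.
Local Open Scope ring_scope.

(** Replaces [p <= q] in the comparisons below. It follows from [p <= q], and within a cell it holds
    in both directions, so one comparison of games yields both monotonicity and constancy. *)
Definition spreads_from {R : realType} (H : hypergraph) (p q : R) : Prop :=
  forall (F e : {set H}), e \in edges H -> ignites q F e -> ignites p F e.

Lemma ignitesE (R : realType) (H : hypergraph) (p : R) (F e : {set H}) :
  ignites p F e = (p * #|e|%:R <= #|e :&: F|%SET%:R).
Proof. by rewrite /ignites ceil_le_int. Qed.

Lemma le_spreads_from (R : realType) (H : hypergraph) (p q : R) :
  p <= q -> spreads_from H p q.
Proof.
by move=> pq F e _; rewrite !ignitesE; apply: le_trans; rewrite ler_wpM2r.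
Qed.

Lemma propagateS (R : realType) (H : hypergraph) (p q : R) (F G : {set H}) :
  spreads_from H p q -> F \subset G -> propagate q F \subset propagate p G.
Proof.
move=> pq FG; apply: finset.setUSS => //; apply/fintype.subsetP => v; rewrite !inE.
move=> /hasP[e eH /andP[eF ve]]; apply/hasP; exists e; rewrite // ve andbT.
move: (pq _ _ eH eF); rewrite !ignitesE => /le_trans; apply.
by rewrite ler_nat subset_leq_card// finset.setIS.
Qed.

(* A source that is already on fire in the faster game is replaced by any vertex not
   on fire; if there is none, the faster game is over. *)
Lemma legal_dominating (R : realType) (H : hypergraph) (p q : R) (u : seq H)
    (F G : {set H}) :
  spreads_from H p q -> F \subset G ->
  exists w, [/\ legal p G w, (size w <= size u)%N &
    foldl (play_round q) F u \subset foldl (play_round p) G w].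
Proof.
move=> pq; elim: u F G => [|v u IHu] F G FG; first by exists [::].
have step v' : v' \notin G -> (v == v') || (v \in G) ->
    exists w, [/\ legal p G w, (size w <= (size u).+1)%N &
    foldl (play_round q) (play_round q F v) u \subset
      foldl (play_round p) G w].
  move=> v'G vv'; have : play_round q F v \subset play_round p G v'.
    rewrite finset.subUset finset.sub1set !inE orbA vv' /=.
    exact/(fintype.subset_trans (propagateS _ _ _ _ _ _ pq FG))/finset.subsetUr.
  move=> /IHu[w [lw sw bw]]; exists (v' :: w); split => //=.
  by rewrite v'G.
have [vG|vG] := boolP (v \in G); last by apply: (step v); rewrite ?eqxx.
have [->|] := eqVneq G [set: H]%SET.
  by exists [::]; split=> //; exact: finset.subsetT.
rewrite -finset.subTset => /fintype.subsetPn[v' _ v'G].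
by apply: (step v'); rewrite // vG orbT.
Qed.

(** Each source is a vertex not yet on fire, so every round adds at least one. This bounds the
    length of a legal sequence by [#|H|]. *)
Lemma legal_size (R : realType) (H : hypergraph) (p : R) (u : seq H)
    (F : {set H}) :
  legal p F u -> (#|F| + size u <= #|foldl (play_round p) F u|)%N.
Proof.
elim: u F => [|v u IHu] F /=; first by rewrite addn0.
move=> /andP[vF /IHu]; apply: leq_trans; rewrite addnS -addSn leq_add2r.
have -> : #|F|.+1 = #|v |: F|%SET by rewrite cardsU1 vF.
exact/subset_leq_card/finset.setUS/finset.subsetUl.
Qed.

Lemma burning_number_le (R : realType) (H : hypergraph) (p q : R) :
  spreads_from H p q -> (burning_number H p <= burning_number H q)%N.
Proof.
move=> pq; rewrite [X in (_ <= X)%N]/burning_number.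
case: ex_minnP => k /existsP[u /andP[_ /eqP bu]] _.
have [w [lw]] :=
  legal_dominating _ _ _ _ u _ _ pq (fintype.subxx finset.set0).
rewrite -/(burned q u) bu finset.subTset -/(burned p w) size_tuple => wu bw.
apply: leq_trans wu; rewrite /burning_number; case: ex_minnP => j _; apply.
by apply/existsP; exists (in_tuple w); apply/andP.
Qed.

Lemma burning_number_bounds (R : realType) (H : hypergraph) (p : R) :
  (1 <= burning_number H p <= #|H|)%N.
Proof.
rewrite /burning_number; case: ex_minnP => k /existsP[u /andP[lu bu]] _.
apply/andP; split; last first.
  have := legal_size _ _ _ _ _ lu; rewrite size_tuple cards0 => /leq_trans.
  by apply; exact: max_card.
case: k u lu bu => // u _; rewrite tuple0 /burned /= => /eqP H0.
by have := vertex_gt0 H; rewrite -cardsT -H0 cards0.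
Qed.

(** An optimal set [S] for [q] also works for [p]: by induction on the rounds, the fire under [p]
    contains the fire under [q]. *)
Lemma lazy_burning_number_le (R : realType) (H : hypergraph) (p q : R) :
  spreads_from H p q -> (lazy_burning_number H p <= lazy_burning_number H q)%N.
Proof.
move=> pq; rewrite [X in (_ <= X)%N]/lazy_burning_number.
case: ex_minnP => k /existsP[S /andP[kS /asboolP bS]] _.
rewrite /lazy_burning_number; case: ex_minnP => j _; apply.
apply/existsP; exists S; rewrite kS; apply/asboolP => v.
have [r vr] := bS v; exists r; apply: fintype.subsetP vr.
by elim: r => //= r; exact: propagateS.
Qed.

(** Positivity of [p] gives the lower bound: for [p <= 0] even the empty set ignites every edge. *)
Lemma lazy_burning_number_bounds (R : realType) (H : hypergraph) (p : R) :
  0 < p -> (1 <= lazy_burning_number H p <= #|H|)%N.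
Proof.
move=> p0; rewrite /lazy_burning_number.
case: ex_minnP => k /existsP[S /andP[/eqP <- /asboolP bS]] _.
rewrite max_card andbT card_gt0; apply/eqP => S0.
have /card_gt0P[v _] := vertex_gt0 H; have [r] := bS v.
suff -> : iter r (propagate p) S = finset.set0 by rewrite inE.
by rewrite S0; elim: r => //= r ->; exact: propagate0.
Qed.

Lemma breakpoint_in01 (R : realType) (H : hypergraph) (z : R) :
  breakpoints R H z -> 0 < z < 1.
Proof.
move=> [x [j [_ /andP[j0 jx] ->]]].
(* The predecessor of 0 is 0, so the size [x = 0] of an empty edge is excluded by [1 <= j]. *)
have jltx : (j < x)%N by case: x jx => [|x] //=; rewrite leqNgt j0.
have x0 : (0 < x)%N by exact: leq_trans jltx.
by rewrite divr_gt0 ?ltr0n//= ltr_pdivrMr ?ltr0n// mul1r ltr_nat.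
Qed.

(** With [k] burning vertices in a nonempty [e], the test is [p <= k / #|e|]. It fails under [q] if
    [k = 0], holds under [p] if [k = #|e|], and otherwise compares with a breakpoint. *)
Lemma spreads_from_breakpoints (R : realType) (H : hypergraph) (p q : R) :
  p < 1 -> 0 < q ->
  (forall z, breakpoints R H z -> q <= z -> p <= z) -> spreads_from H p q.
Proof.
move=> p1 q0 pq F e eH; rewrite !ignitesE.
have [->|e0] := posnP #|e|; first by rewrite !mulr0.
have e0R : 0 < #|e|%:R :> R by rewrite ltr0n.
rewrite -!ler_pdivlMr//.
have [->|k0] := posnP #|(e :&: F)%SET|.
  by rewrite mul0r leNgt q0.
have := subset_leq_card (finset.subsetIl e F); rewrite leq_eqVlt.
move=> /predU1P[->|ke]; first by rewrite divff ?gt_eqF// (ltW p1).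
apply: pq; exists #|e|, #|(e :&: F)%SET|; split => //.
  by rewrite mem_undup; apply/mapP; exists e.
by rewrite k0 -ltnS prednK.
Qed.

(** The left end 0 is generalized to [a] for the induction on [y]. Since cells are closed on the
    right, the test against [z] has the same outcome for all points of a cell, even when [z] is an
    endpoint. *)
Lemma cell_path (R : realType) (a : R) (y : seq R) (I : interval R) :
  path <%R a y -> {in a :: y, forall z, z < 1} ->
  I \in rcons (pairmap (fun a b => `]a, b]) a y) `]last a y, 1[ ->
  forall p, p \in I -> a < p < 1 /\
    (forall q, q \in I -> {in a :: y, forall z, q <= z -> p <= z}).
Proof.
elim: y a => [|b y IHy] a /=.
  move=> _ _; rewrite inE => /eqP-> p; rewrite in_itv/= => p01; split => //.
  move=> q; rewrite in_itv/= => /andP[aq _] z; rewrite inE => /eqP->.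
  by rewrite leNgt aq.
move=> /andP[ab yb] y1; rewrite inE => /predU1P[-> p|Iy p pI].
  rewrite in_itv/= => /andP[ap pb]; split.
    by rewrite ap (le_lt_trans pb)// y1// !inE eqxx orbT.
  move=> q; rewrite in_itv/= => /andP[aq _] z; rewrite inE.
  move=> /predU1P[->|]; first by rewrite leNgt aq.
  rewrite inE => /predU1P[->//|zy] _; apply: (le_trans pb).
  by move: yb; rewrite lt_path_sortedE => /andP[/allP/(_ _ zy)/ltW].
have y1' : {in b :: y, forall z, z < 1}.
  by move=> z zy; apply: y1; rewrite inE zy orbT.
have IHI := IHy _ yb y1' Iy.
have [/andP[bp p1] pz] := IHI _ pI; split; first by rewrite (lt_trans ab).
(* A later cell lies to the right of [b], hence of [a], so [q <= a] is impossible. *)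
move=> q qI z; rewrite inE => /predU1P[->|]; last exact: pz.
have [/andP[bq _] _] := IHI _ qI.
by rewrite leNgt (lt_trans ab).
Qed.

Lemma level_set_interval (R : realType) (f : R -> nat) (j : nat) :
  (forall p q, p <= q -> (f p <= f q)%N) ->
  is_interval [set p : R | 0 < p < 1 /\ f p = j].
Proof.
move=> f_le p q /= [/andP[p0 _] fp] [/andP[_ q1] fq] z /andP[pz zq].
split; first by rewrite (lt_le_trans p0)// (le_lt_trans zq).
by apply/eqP; rewrite eqn_leq -{1}fq -fp !f_le.
Qed.

(** Serves both distributions, with [f] the burning or the lazy burning number. *)
Lemma cell_in_part (R : realType) (H : hypergraph) (f : R -> nat)
    (A : set R) :
  (forall p q, spreads_from H p q -> (f p <= f q)%N) ->
  (forall p, 0 < p -> (1 <= f p <= #|H|)%N) ->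
  (forall p, A p -> 0 < p < 1) ->
  (forall p q, A p -> A q -> spreads_from H p q) ->
  exists P : set R,
    [/\ [set [set p : R | 0 < p < 1 /\ f p = j]
          | j in [set j : nat | (1 <= j <= #|H|)%N]] P,
        is_interval P & A `<=` P].
Proof.
move=> f_le f_bounds A01 AA.
have [p0 p00 Ap0] : exists2 p0 : R, 0 < p0 & forall p, A p -> f p = f p0.
  (* For empty [A] any positive base point will do, as positivity alone puts [f p0] among the
     indices. *)
  have [->|/set0P[p0 Ap0]] := eqVneq A set0; first by exists 1.
  exists p0 => [|p Ap]; first by have /andP[] := A01 _ Ap0.
  (* [AA] is used for both orders of the two points, which gives both inequalities. *)
  by apply/eqP; rewrite eqn_leq !f_le//; exact: AA.
exists [set p : R | 0 < p < 1 /\ f p = f p0]; split.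
- by exists (f p0) => //; exact: f_bounds.
- by apply: level_set_interval => p q pq; apply/f_le/le_spreads_from.
- by move=> p Ap; split; [exact: A01|exact: Ap0].
Qed.

Theorem theorem3p11 (R : realType) (H : hypergraph) (y : seq R) :
  breakpoints R H !=set0 ->
  [set` y] = breakpoints R H ->
  sorted <%R y ->
  forall I : interval R, I \in cells y ->
    (exists P : set R,
       [/\ burning_distribution R H P, is_interval P & [set` I] `<=` P]) /\
    (exists Q : set R,
       [/\ lazy_burning_distribution R H Q, is_interval Q & [set` I] `<=` Q]).
Proof.
move=> _ yH y_sorted I Iy.
have y01 z : z \in y -> 0 < z < 1.
  by move=> zy; apply: (@breakpoint_in01 _ H); rewrite -yH.
have y_path : path <%R 0 y.
  by rewrite path_min_sorted//; apply/allP => z /y01/andP[].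
have y_lt1 : {in 0 :: y, forall z, z < 1}.
  by move=> z; rewrite inE => /predU1P[->//|/y01/andP[]].
have cellI := cell_path _ _ _ _ y_path y_lt1 Iy.
have I01 p : [set` I] p -> 0 < p < 1 by move=> /cellI[].
have II p q : [set` I] p -> [set` I] q -> spreads_from H p q.
  move=> pI qI; have [/andP[_ p1] pz] := cellI _ pI.
  have /andP[q0 _] := I01 _ qI.
  apply: spreads_from_breakpoints => // z; rewrite -yH => zy.
  by apply: pz => //; rewrite inE; apply/orP; right.
split; apply: (@cell_in_part _ H) => //.
- exact: burning_number_le.
- by move=> p _; exact: burning_number_bounds.
- exact: lazy_burning_number_le.
- exact: lazy_burning_number_bounds.
Qed.
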